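(* Let $N,s,p$ be positive integers, let $\mathbf{D},\widehat{\mathbf{D}}\in\mathbb{R}^{(N+1)s\times(N+1)s}$ and $\mathbf{R},\widehat{\mathbf{R}}\in\mathbb{R}^{(N+1)p\times(N+1)p}$ be symmetric positive definite, and let $\mathbf{L},\widehat{\mathbf{L}},\mathbf{H},\mathbf{S},\widetilde{\mathbf{S}},\widehat{\mathbf{S}},\mathcal{A},\mathcal{P}_D$ be the matrices defined in the context, with $\mathbf{S},\widetilde{\mathbf{S}},\widehat{\mathbf{S}}$ symmetric positive definite. Suppose that $\lambda_{\mathbf{D}},\Lambda_{\mathbf{D}},\lambda_{\mathbf{R}},\Lambda_{\mathbf{R}},\lambda_{\mathbf{S}},\Lambda_{\mathbf{S}},\lambda_{\mathbf{L}},\Lambda_{\mathbf{L}}$ are positive real numbers with $$\lambda(\widehat{\mathbf{D}}^{-1}\mathbf{D})\in[\lambda_{\mathbf{D}},\Lambda_{\mathbf{D}}],\quad \lambda(\widehat{\mathbf{R}}^{-1}\mathbf{R})\in[\lambda_{\mathbf{R}},\Lambda_{\mathbf{R}}],\quad \lambda(\widetilde{\mathbf{S}}^{-1}\mathbf{S})\in[\lambda_{\mathbf{S}},\Lambda_{\mathbf{S}}],\quad \lambda\left((\widehat{\mathbf{L}}^\top\widehat{\mathbf{L}})^{-1}(\mathbf{L}^\top\mathbf{L})\right)\in[\lambda_{\mathbf{L}},\Lambda_{\mathbf{L}}].$$ Set $\lambda_{\boldsymbol\Phi}=\min\{\lambda_{\mathbf{D}},\lambda_{\mathbf{R}}\}$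 and $\Lambda_{\boldsymbol\Phi}=\max\{\Lambda_{\mathbf{D}},\Lambda_{\mathbf{R}}\}$. Then the eigenvalues of $\mathcal{P}_D^{-1}\mathcal{A}$ are real, and satisfy $$\begin{aligned} \lambda(\mathcal{P}_D^{-1}\mathcal{A})\in{}&\left[\frac{\lambda_{\boldsymbol\Phi}-\sqrt{\lambda_{\boldsymbol\Phi}^2+4\Lambda_{\boldsymbol\Phi}\Lambda_{\mathbf{S}}\Lambda_{\mathbf{L}}\kappa(\mathbf{D})}}{2},\ \frac{\Lambda_{\boldsymbol\Phi}-\sqrt{\Lambda_{\boldsymbol\Phi}^2+\frac{4\lambda_{\boldsymbol\Phi}\lambda_{\mathbf{S}}\lambda_{\mathbf{L}}}{\kappa(\mathbf{D})}}}{2}\right]\cup[\lambda_{\boldsymbol\Phi},\Lambda_{\boldsymbol\Phi}]\\ &\cup\left[\frac{\lambda_{\boldsymbol\Phi}+\sqrt{\lambda_{\boldsymbol\Phi}^2+\frac{4\lambda_{\boldsymbol\Phi}\lambda_{\mathbf{S}}\lambda_{\mathbf{L}}}{\kappa(\mathbf{D})}}}{2},\ \frac{\Lambda_{\boldsymbol\Phi}+\sqrt{\Lambda_{\boldsymbol\Phi}^2+4\Lambda_{\boldsymbol\Phi}\Lambda_{\mathbf{S}}\Lambda_{\mathbf{L}}\kappa(\mathbf{D})}}{2}\right]. \end{aligned}$$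
   Context: Notation: $\lambda(\cdot)$ denotes the eigenvalues of a matrix, and $\lambda(X)\in I$ means that every eigenvalue of $X$ lies in the set $I$. $\kappa(\mathbf{D})$ is the (2-norm) condition number of $\mathbf{D}$, i.e. the ratio of its largest to its smallest eigenvalue. Setting (weak-constraint 4D-Var saddle point system): $\mathbf{D}=\mathrm{blkdiag}(\mathbf{B},\mathbf{Q}_1,\dots,\mathbf{Q}_N)$ with $s\times s$ diagonal blocks; $\mathbf{R}=\mathrm{blkdiag}(\mathbf{R}_0,\dots,\mathbf{R}_N)$ with $p\times p$ diagonal blocks; $\mathbf{H}=\mathrm{blkdiag}(\mathbf{H}_0,\dots,\mathbf{H}_N)\in\mathbb{R}^{(N+1)p\times(N+1)s}$ with arbitrary real blocks $\mathbf{H}_i\in\mathbb{R}^{p\times s}$. The matrix $\mathbf{L}\in\mathbb{R}^{(N+1)s\times(N+1)s}$ is block lower bidiagonal with $s\times s$ blocks: its diagonal blocks are identity matrices, its $(j+1,j)$th block is $-\mathbf{M}_j$ for $j=1,\dots,N$ with $\mathbf{M}_j\in\mathbb{R}^{s\times s}$, and all other blocks are zero. The matrix $\widehat{\mathbf{L}}\in\mathbb{R}^{(N+1)s\times(N+1)s}$ is an invertible approximation of $\mathbf{L}$; $\widehat{\mathbf{D}}$ and $\widehat{\mathbf{R}}$ are approximations of $\mathbf{D}$ and $\mathbf{R}$. Define $$\mathbf{S}=\mathbf{L}^\top\mathbf{D}^{-1}\mathbf{L}+\mathbf{H}^\top\mathbf{R}^{-1}\mathbf{H},\qquad \widetilde{\mathbf{S}}=\mathbf{L}^\top\mathbf{D}^{-1}\mathbf{L},\qquad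 \widehat{\mathbf{S}}=\widehat{\mathbf{L}}^\top\mathbf{D}^{-1}\widehat{\mathbf{L}},$$ $$\mathcal{A}=\begin{pmatrix}\mathbf{D}&\mathbf{0}&\mathbf{L}\\ \mathbf{0}&\mathbf{R}&\mathbf{H}\\ \mathbf{L}^\top&\mathbf{H}^\top&\mathbf{0}\end{pmatrix},\qquad \mathcal{P}_D=\begin{pmatrix}\widehat{\mathbf{D}}&\mathbf{0}&\mathbf{0}\\ \mathbf{0}&\widehat{\mathbf{R}}&\mathbf{0}\\ \mathbf{0}&\mathbf{0}&\widehat{\mathbf{S}}\end{pmatrix}.$$ *)

(* Defs.v *)
From mathcomp Require Import all_boot all_order all_algebra.
From mathcomp Require Import classical_sets set_interval reals.
From mathcomp Require Export complex.
Set Implicit Arguments.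
Unset Strict Implicit.
Unset Printing Implicit Defensive.
Import Order.TTheory GRing.Theory Num.Theory.
Local Open Scope classical_set_scope.
Local Open Scope ring_scope.

(* A vector of (N+1) blocks of size s lives in dimension \sum_(i < N.+1) s,
   the index type of the library's block matrices. *)

Definition posdefmx (K : realType) (n : nat) (X : 'M[K]_n) : Prop :=
  X \is symmetricmx /\
  forall v : 'cV[K]_n, v != 0 -> 0 < (v^T *m X *m v) ord0 ord0.

(* z is an eigenvalue, real or not, of the real matrix X. *)
Definition complex_eigenvalue (K : realType) (n : nat) (X : 'M[K]_n)
    (z : K[i]) : bool :=
  eigenvalue (map_mx (real_complex K) X) z.

(* lambda(X) \in I: all the complex eigenvalues of X are real and lie in I. *)
Definition spectrum_in (K : realType) (n : nat) (X : 'M[K]_n) (I : set K) :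
    Prop :=
  forall z : K[i], complex_eigenvalue X z ->
    exists2 x : K, I x & z = real_complex K x.

(* Meaningful for symmetric positive definite X of size at least 1: the set of
   real eigenvalues is then the whole spectrum, finite and nonempty, so that
   sup and inf are its maximum and minimum. *)
Definition condition_number (K : realType) (n : nat) (X : 'M[K]_n) : K :=
  sup [set x : K | eigenvalue X x] / inf [set x : K | eigenvalue X x].

Definition Dmx (K : realType) (N s : nat) (B : 'M[K]_s) (Q : 'I_N -> 'M[K]_s) :
    'M[K]_(\sum_(i < N.+1) s) :=
  \mxdiag_(i < N.+1) (if unlift ord0 i is Some j then Q j else B).

Definition Rmx (K : realType) (N p : nat) (Rb : 'I_N.+1 -> 'M[K]_p) :
    'M[K]_(\sum_(i < N.+1) p) :=
  \mxdiag_(i < N.+1) Rb i.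

(* \mxdiag only covers square diagonal blocks. *)
Definition Hmx (K : realType) (N s p : nat) (Hb : 'I_N.+1 -> 'M[K]_(p, s)) :
    'M[K]_(\sum_(i < N.+1) p, \sum_(i < N.+1) s) :=
  \mxblock_(i < N.+1, j < N.+1) (if i == j then Hb i else 0).

(* M k stands for M_{k+1}: it sits, negated, in the 0-based block (k+1, k), and
   unlift ord0 i = Some k means that i = k+1. *)
Definition Lmx (K : realType) (N s : nat) (M : 'I_N -> 'M[K]_s) :
    'M[K]_(\sum_(i < N.+1) s) :=
  \mxblock_(i < N.+1, j < N.+1)
    (if i == j then 1%:M
     else if unlift ord0 i is Some k
          then (if (j : nat) == k then - M k else 0)
          else 0).

Definition saddle_mx (K : realType) (m q : nat) (D : 'M[K]_m) (R : 'M[K]_q)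
    (L : 'M[K]_m) (H : 'M[K]_(q, m)) : 'M[K]_(m + q + m) :=
  block_mx (block_mx D 0 0 R) (col_mx L H) (row_mx L^T H^T) 0.

Definition block_diag_precond (K : realType) (m q : nat) (Dh : 'M[K]_m)
    (Rh : 'M[K]_q) (Sh : 'M[K]_m) : 'M[K]_(m + q + m) :=
  block_mx (block_mx Dh 0 0 Rh) 0 0 Sh.

(* Main.v *)
Require Import Defs.
From mathcomp Require Import all_boot all_order all_algebra.
From mathcomp Require Import classical_sets set_interval reals.
From mathcomp Require Import ring lra.
Set Implicit Arguments.
Unset Strict Implicit.
Unset Printing Implicit Defensive.
Import Order.TTheory GRing.Theory Num.Theory.

(** Since the preconditioner [P] is positive definite and the saddle point
    matrix is symmetric, an eigenvalue of [P^-1 A] is a number [x] such that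
    [A v = x P v] for some [v != 0]; it is real.  Write [v = (f, w)],
    [Phi = diag(D, R)], [Phih = diag(Dh, Rh)] and [Psi = (L; H)], so that
    [Phi f + Psi w = x Phih f] and [Psi^T f = x Sh w].  Put [T = x Phih - Phi].
    Then [T f = Psi w] and [f^T T f = x w^T Sh w].

    The spectral hypotheses are used only through the quadratic forms they
    bound ([pencil_qf_bounds]).  From [l Phih <= Phi <= u Phih] the matrix [T]
    is positive definite for [x > u] and negative definite for [x < l], and it
    is squeezed between explicit multiples of [Phih].  Comparison of inverses
    ([qf_inverse_bounds]) therefore bounds [f^T T f] by multiples of
    [(Psi w)^T Phih^-1 (Psi w)].  The same principle compares that quantity
    with [w^T S w], hence with [w^T St w], and finally with [w^T Sh w]: the last
    step loses the condition number of [D], because [D^-1] lies between the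
    inverses of the extreme eigenvalues of [D] ([qf_Schur_precond_bounds]).
    What remains is a pair of quadratic inequalities in [x] when [x < 0] or
    [x > u], and a contradiction when [0 <= x < l]
    ([saddle_eigenvalue_quadratics]); the bounds of the theorem are the roots
    of these quadratics ([quadratic_intervals]).

    The quadratic form bounds come from the simultaneous diagonalization of a
    symmetric [X] and a positive definite [Y] by a complex congruence
    ([pencil_diag]), whose diagonal entries are eigenvalues of [Y^-1 X]. *)

Local Open Scope classical_set_scope.
Local Open Scope ring_scope.

(** * Simultaneous diagonalization and eigenvalues of symmetric pencils *)

Section HermitianPencil.
Local Open Scope sesquilinear_scope.

(** Simultaneous diagonalization by congruence: after diagonalizing [Y] and
    rescaling to turn it into the identity, a unitary change of basis
    diagonalizes what [X] has become. *)
Lemma hermitian_pencil_diag (C : numClosedFieldType) n (X Y : 'M[C]_n) :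
  X \is hermsymmx -> Y \is hermsymmx ->
  (forall a, eigenvalue Y a -> 0 < a) ->
  exists V : 'M[C]_n, exists2 e : 'rV[C]_n, e \is a realmx &
    V *m Y *m V^t* = 1%:M /\ V *m X *m V^t* = diag_mx e.
Proof.
move=> hX hY Ypos.
set P := spectralmx Y; set d := spectral_diag Y.
have PU : P \is unitarymx by exact: spectral_unitarymx.
have Yd : Y = P^t* *m diag_mx d *m P.
  by rewrite -(invmx_unitary PU); apply/orthomx_spectralP/hermitian_normalmx.
have dpos i : 0 < d 0 i.
  apply: Ypos; apply/eigenvalueP; exists (row i P).
    have -> : row i P *m Y = row i (P *m Y) by rewrite row_mul.
    rewrite Yd !mulmxA (unitarymxP PU) mul1mx.
    by apply/rowP => j; rewrite mul_diag_mx !mxE.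
  by apply/eqP => /(congr1 (fun r => r *m P^t*));
    rewrite mul0mx -row_mul (unitarymxP PU) => /rowP/(_ i)/eqP;
    rewrite !mxE eqxx oner_eq0.
(* The rescaling [g] turns the diagonal form of [Y] into the identity. *)
pose g : 'rV[C]_n := \row_i (sqrtC (d 0 i))^-1.
have gt : (diag_mx g)^t* = diag_mx g.
  rewrite tr_diag_mx map_diag_mx; congr diag_mx; apply/rowP => i; rewrite !mxE.
  by apply/CrealP/ger0_real; rewrite invr_ge0 sqrtC_ge0 ltW.
pose W := diag_mx g *m P.
have Wt : W^t* = P^t* *m diag_mx g by rewrite trmx_mul map_mxM /= gt.
have WY : W *m Y *m W^t* = 1%:M.
  rewrite Wt Yd /W !mulmxA !(mulmxtVK _ PU) !mulmx_diag.
  apply/matrixP => i j; rewrite !mxE; congr (_ *+ _).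
  rewrite mulrAC -invfM -expr2 sqrtCK mulVf //; exact: lt0r_neq0.
clear Wt; clearbody W.
pose X' := W *m X *m W^t*.
have tX : X^t* = X.
  by move/is_hermitianmxP: hX => {2}->; rewrite expr0 scale1r.
have hX' : X' \is hermsymmx.
  apply/is_hermitianmxP; rewrite expr0 scale1r !trmx_mul !map_mxM /= trmxCK.
  by rewrite tX mulmxA.
set Q := spectralmx X'.
have QU : Q \is unitarymx by exact: spectral_unitarymx.
have Xd : X' = Q^t* *m diag_mx (spectral_diag X') *m Q.
  by rewrite -(invmx_unitary QU); apply/orthomx_spectralP/hermitian_normalmx.
exists (Q *m W); exists (spectral_diag X').
  exact: hermitian_spectral_diag_real.
have Vt : (Q *m W)^t* = W^t* *m Q^t* by rewrite trmx_mul map_mxM.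
have E Z : Q *m W *m Z *m (Q *m W)^t* = Q *m (W *m Z *m W^t*) *m Q^t*.
  by rewrite Vt !mulmxA.
split; first by rewrite E WY mulmx1 (unitarymxP QU).
by rewrite E -/X' [X in _ *m X *m _]Xd !mulmxA (unitarymxP QU) mul1mx mulmxtVK.
Qed.

End HermitianPencil.

Section QuadraticForms.
Local Open Scope sesquilinear_scope.
Variable K : realType.
Implicit Types (n m : nat).

(** The value [v^T X v] of the quadratic form of [X]; [X] need not be
    symmetric. *)
Definition qf n (X : 'M[K]_n) (v : 'cV[K]_n) : K := (v^T *m X *m v) 0 0.

(** The embedding of real matrices into complex ones. *)
Local Notation cplx := (map_mx (real_complex K)).

Lemma trmx_symmetricmx n (X : 'M[K]_n) : X \is symmetricmx -> X^T = X.
Proof.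
by move/is_hermitianmxP => {2}->; rewrite expr0 scale1r map_mx_id.
Qed.

Lemma hermsymmx_cplx n (X : 'M[K]_n) :
  X \is symmetricmx -> cplx X \is hermsymmx.
Proof.
move=> /trmx_symmetricmx sX; apply/is_hermitianmxP; rewrite expr0 scale1r.
apply/matrixP => i j; rewrite !mxE -{1}sX mxE.
by apply/esym/CrealP/complex_realP; exists (X j i).
Qed.

Lemma complex_eigenvalueR n (X : 'M[K]_n) x :
  complex_eigenvalue X (real_complex K x) = eigenvalue X x.
Proof. exact: eigenvalue_map. Qed.

Lemma eigenvalue_cV n (X : 'M[K]_n) x : eigenvalue X^T x ->
  exists2 v : 'cV[K]_n, X *m v = x *: v & v != 0.
Proof.
move=> /eigenvalueP[v vX v0]; exists v^T; last by rewrite trmx_eq0.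
by rewrite -[X]trmxK -trmx_mul vX linearZ.
Qed.

Lemma dotmx_gt0 n (v : 'cV[K]_n) : v != 0 -> 0 < (v^T *m v) 0 0.
Proof.
move=> v0; rewrite mxE lt0r; apply/andP; split.
  apply: contra v0; rewrite psumr_eq0 => [/allP h|i _]; last first.
    by rewrite mxE -expr2 sqr_ge0.
  apply/eqP/colP => i; rewrite mxE.
  have /eqP := h i (mem_index_enum _); rewrite mxE -expr2 => /eqP.
  by rewrite sqrf_eq0 => /eqP.
by apply: sumr_ge0 => i _; rewrite mxE -expr2 sqr_ge0.
Qed.

Lemma posdefmx_eigenvalue_gt0 n (X : 'M[K]_n) x :
  posdefmx X -> eigenvalue X x -> 0 < x.
Proof.
move=> [/trmx_symmetricmx sX pX]; rewrite -{1}sX => /eigenvalue_cV[v Xv v0].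
have := pX v v0; rewrite -mulmxA Xv -scalemxAr mxE pmulr_lgt0 //.
exact: dotmx_gt0.
Qed.

Lemma posdefmx_unit n (X : 'M[K]_n) : posdefmx X -> X \in unitmx.
Proof.
move=> pX; rewrite -row_free_unit -kermx_eq0; apply/negbNE/negP => h.
suff /(posdefmx_eigenvalue_gt0 pX) : eigenvalue X 0 by rewrite ltxx.
by rewrite /eigenvalue /eigenspace raddf0 subr0.
Qed.

Lemma symmetricmx_eigenvalue_real n (X : 'M[K]_n) z : X \is symmetricmx ->
  complex_eigenvalue X z -> z \is Num.real.
Proof.
move=> /hermsymmx_cplx hX /eigenvalueP[v vX v0].
set P := spectralmx (cplx X); set d := spectral_diag (cplx X).
have PU : P \is unitarymx by exact: spectral_unitarymx.
have Xd : cplx X = P^t* *m diag_mx d *m P.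
  by rewrite -(invmx_unitary PU); apply/orthomx_spectralP/hermitian_normalmx.
pose y := v *m P^t*.
have y0 : y != 0.
  apply: contra v0 => /eqP y0; apply/eqP.
  by rewrite -[v](mulmxKtV _ PU) // -/y y0 mul0mx.
have yd : y *m diag_mx d = z *: y.
  rewrite /y scalemxAl -vX Xd !mulmxA mulmxtVK //.
clearbody y; case/rV0Pn: y0 => i yi.
move/rowP/(_ i): yd; rewrite mul_mx_diag !mxE mulrC => /(mulIf yi) <-.
exact: (mxOverP (hermitian_spectral_diag_real hX)).
Qed.

(** The congruence [V] may be complex, but the diagonal is real and consists of
    eigenvalues of [Y^-1 X] over the base field. *)
Lemma pencil_diag n (X Y : 'M[K]_n) : X \is symmetricmx -> posdefmx Y ->
  exists V : 'M[K[i]]_n, exists e : 'rV[K]_n,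
    [/\ V *m (cplx Y) *m V^t* = 1%:M, V *m (cplx X) *m V^t* = diag_mx (cplx e),
     V \in unitmx & forall i, eigenvalue (invmx Y *m X) (e 0 i)].
Proof.
move=> sX pY; have sY := pY.1.
have [a ea|V [e er [VY VX]]] :=
    hermitian_pencil_diag (hermsymmx_cplx sX) (hermsymmx_cplx sY).
  have /complex_realP[x ax] := symmetricmx_eigenvalue_real sY ea.
  move: ea; rewrite ax => ea; rewrite ltcR.
  by apply: posdefmx_eigenvalue_gt0 pY _; rewrite -complex_eigenvalueR.
have [Vu Vtu] : V \in unitmx /\ (cplx Y) *m V^t* \in unitmx.
  by apply: mulmx1_unit; rewrite mulmxA.
pose r : 'rV[K]_n := \row_i complex.Re (e 0 i).
have rE : e = cplx r.
  by apply/rowP => i; rewrite !mxE RRe_real //; apply: (mxOverP er).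
exists V, r; split=> //; rewrite -?rE // => i.
rewrite -complex_eigenvalueR /complex_eigenvalue; apply/eigenvalueP.
have Yu : (cplx Y) \in unitmx by rewrite map_unitmx posdefmx_unit.
have VXE : V *m (cplx X) = diag_mx e *m (V *m (cplx Y)).
  have Vi : V *m (cplx Y) *m V^t* = 1%:M by [].
  have Vtu' : V^t* \in unitmx by move: Vtu; rewrite unitmx_mul => /andP[].
  apply: (can_inj (mulmxK Vtu')); rewrite VX -mulmxA Vi mulmx1 //.
exists (row i (V *m (cplx Y))).
  rewrite map_mxM map_invmx -!row_mul !mulmxA mulmxK // VXE.
  by apply/rowP => j; rewrite mul_diag_mx rE !mxE.
apply/negP => /eqP /(congr1 (fun r => r *m V^t*)).
rewrite mul0mx -row_mul VY => /rowP/(_ i)/eqP.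
by rewrite !mxE eqxx oner_eq0.
Qed.

(** In the diagonalizing coordinates, with [w i] the squared modulus of the
    [i]-th coordinate of [v], both quadratic forms are sums over the [w i]. *)
Lemma pencil_qf n (X Y : 'M[K]_n) : X \is symmetricmx -> posdefmx Y ->
  exists e : 'rV[K]_n, (forall i, eigenvalue (invmx Y *m X) (e 0 i)) /\
    forall v, exists2 w : 'I_n -> K, forall i, 0 <= w i &
      qf Y v = \sum_i w i /\ qf X v = \sum_i e 0 i * w i.
Proof.
move=> sX pY; have [V [e [VY VX Vu eE]]] := pencil_diag sX pY.
exists e; split=> // v.
pose y := (cplx v^T) *m invmx V.
have vy : (cplx v^T) = y *m V by rewrite mulmxKV.
clearbody y.
have qE (Z : 'M[K]_n) : real_complex K (qf Z v) =
    (y *m (V *m (cplx Z) *m V^t*) *m y^t*) 0 0.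
  have -> : y *m (V *m (cplx Z) *m V^t*) *m y^t* =
      (y *m V) *m (cplx Z) *m (y *m V)^t*.
    by rewrite trmx_mul map_mxM !mulmxA.
  rewrite -vy; have -> : ((cplx v^T))^t* = cplx v.
    apply/matrixP => i j; rewrite !mxE.
    by apply/CrealP/complex_realP; exists (v i j).
  by rewrite -!map_mxM [RHS]mxE.
pose w i := complex.Re (`|y 0 i| ^+ 2).
have wE i : real_complex K (w i) = `|y 0 i| ^+ 2.
  by rewrite RRe_real // ger0_real // exprn_ge0.
exists w => [i|]; first by rewrite -ler0c wE exprn_ge0.
split; apply: (@complexI K).
  rewrite qE VY mulmx1 mxE rmorph_sum /=; apply: eq_bigr => i _.
  by rewrite wE !mxE normCK.
rewrite qE VX mul_mx_diag mxE rmorph_sum /=; apply: eq_bigr => i _.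
by rewrite rmorphM /= wE !mxE normCK mulrAC mulrC mulrA.
Qed.


(** Rayleigh quotient bounds: [a Y <= X <= b Y] as quadratic forms as soon as
    the spectrum of [Y^-1 X] lies in [[a, b]]. *)
Lemma pencil_qf_bounds n (X Y : 'M[K]_n) a b :
  X \is symmetricmx -> posdefmx Y ->
  spectrum_in (invmx Y *m X) `[a, b] ->
  forall v, a * qf Y v <= qf X v <= b * qf Y v.
Proof.
move=> sX pY sp v.
have [e [eE eq]] := pencil_qf sX pY.
have eab i : a <= e 0 i <= b.
  have := sp (real_complex K (e 0 i)); rewrite complex_eigenvalueR => /(_ (eE i)).
  by case=> x; rewrite /= in_itv /= => xab /complexI ->.
have [w w0 [-> ->]] := eq v.
rewrite !mulr_sumr; apply/andP; split; apply: ler_sum => i _;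
  by apply: ler_wpM2r => //; case/andP: (eab i).
Qed.

(** Every complex eigenvalue of [Y^-1 X] is real, and solves the generalized
    eigenvalue problem [X v = x Y v] with a real vector. *)
Lemma pencil_eigenvector_real n (X Y : 'M[K]_n) z :
  X \is symmetricmx -> posdefmx Y ->
  complex_eigenvalue (invmx Y *m X) z ->
  exists2 x : K, z = real_complex K x &
    exists2 v : 'cV[K]_n, X *m v = x *: (Y *m v) & v != 0.
Proof.
move=> sX pY ez; have [V [e [VY VX Vu _]]] := pencil_diag sX pY.
have Yu : Y \in unitmx := posdefmx_unit pY.
have [x zx] : exists x : K, z = real_complex K x.
  move: ez => /eigenvalueP[v vX v0].
  have YCu : cplx Y \in unitmx by rewrite map_unitmx.
  pose q := v *m invmx (cplx Y) *m invmx V.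
  have vq : v = q *m V *m cplx Y by rewrite /q mulmxKV // mulmxKV.
  have vY : v *m invmx (cplx Y) = q *m V by rewrite /q mulmxKV.
  clearbody q.
  have q0 : q != 0 by apply: contra v0 => /eqP q0; rewrite vq q0 !mul0mx.
  have qX : q *m V *m cplx X = z *: (q *m V *m cplx Y).
    by rewrite -vq -vX map_mxM map_invmx mulmxA vY.
  have qe : q *m diag_mx (cplx e) = z *: q.
    rewrite -VX !mulmxA qX -[in RHS](mulmx1 q) -VY.
    by rewrite -scalemxAl !mulmxA.
  case/rV0Pn: q0 => i qi; exists (e 0 i).
  by move/rowP/(_ i): qe; rewrite mul_mx_diag !mxE mulrC => /(mulIf qi) <-.
exists x => //; move: ez; rewrite zx complex_eigenvalueR => /eigenvalueP[v vX v0].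
have sX' := trmx_symmetricmx sX; have sY' := trmx_symmetricmx pY.1.
exists (v *m invmx Y)^T.
  apply: trmx_inj; rewrite linearZ /= !trmx_mul !trmxK sX' sY' mulmxKV //.
  by rewrite -mulmxA.
rewrite trmx_eq0; apply: contra v0 => /eqP v0.
by rewrite -[v](mulmxKV Yu) v0 mul0mx.
Qed.

(** * Comparison of quadratic forms *)

(** The bilinear form [u^T X v]. *)
Definition bf n (X : 'M[K]_n) (u v : 'cV[K]_n) : K := (u^T *m X *m v) 0 0.

Lemma bf_sym n (X : 'M[K]_n) u v : X^T = X -> bf X u v = bf X v u.
Proof.
move=> sX; rewrite /bf -[in LHS](trmxK (_ *m _ *m v)) mxE !trmx_mul trmxK sX.
by rewrite mulmxA.
Qed.

Lemma qf_subZ n (X : 'M[K]_n) c w v : X^T = X ->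
  qf X (w - c *: v) = qf X w - 2 * c * bf X w v + c ^+ 2 * qf X v.
Proof.
move=> sX; have := bf_sym w v sX; rewrite /qf /bf => E.
rewrite [(_ - _)^T]linearB /= [(_ *: _)^T]linearZ /= !(mulmxBl, mulmxBr).
rewrite -!(scalemxAl, scalemxAr) !mxE.
move: E; rewrite !mxE => E.
ring: E.
Qed.

Lemma qfZ n (X : 'M[K]_n) c v : qf X (c *: v) = c ^+ 2 * qf X v.
Proof.
by rewrite /qf [(_ *: _)^T]linearZ /= -!(scalemxAl, scalemxAr) !mxE mulrA.
Qed.

Lemma qf0 n (X : 'M[K]_n) : qf X 0 = 0.
Proof. by rewrite /qf mulmx0 mxE. Qed.

Lemma qf_ge0 n (X : 'M[K]_n) v : posdefmx X -> 0 <= qf X v.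
Proof.
move=> pX; have [->|v0] := eqVneq v 0; first by rewrite qf0.
exact: ltW (pX.2 v v0).
Qed.

Lemma qf_le0 n (X : 'M[K]_n) v : posdefmx X -> qf X v <= 0 -> v = 0.
Proof.
move=> pX; apply: contraTeq => v0; rewrite -ltNge; exact: pX.2.
Qed.

(** Order reversal of inversion: with [z] the common value of [X v] and [Y w],
    the conclusion reads [z^T Y^-1 z <= c z^T X^-1 z] when [X] and [Y] are
    invertible.  Its proof expands the
    nonnegative number [(w - c v)^T X (w - c v)]. *)
Lemma qf_inverse_le n (X Y : 'M[K]_n) c v w : X^T = X ->
  (forall u, 0 <= qf X u) -> 0 < c -> (forall u, qf X u <= c * qf Y u) ->
  X *m v = Y *m w -> qf Y w <= c * qf X v.
Proof.
move=> sX pX c0 XY E.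
have := pX (w - c *: v); rewrite qf_subZ //.
have -> : bf X w v = qf Y w by rewrite /bf /qf -!mulmxA E.
have := XY w => h1 h2.
have : c * qf Y w <= c * (c * qf X v) by lra.
by rewrite ler_pM2l.
Qed.

(** Two-sided form: if [al Y <= T <= be Y] and [z = T v = Y w], then
    [z^T Y^-1 z] lies between [al] and [be] times [z^T T^-1 z]. *)
Lemma qf_inverse_bounds n (T Y : 'M[K]_n) al be v w : T^T = T -> posdefmx Y ->
  0 < al -> (forall u, al * qf Y u <= qf T u <= be * qf Y u) -> 0 < be ->
  T *m v = Y *m w -> al * qf T v <= qf Y w <= be * qf T v.
Proof.
move=> sT pY al0 TY be0 E; apply/andP; split.
  rewrite -ler_pdivlMl //; apply: qf_inverse_le (esym E).
  - exact: trmx_symmetricmx pY.1.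
  - by move=> u; exact: qf_ge0.
  - by rewrite invr_gt0.
  by move=> u; rewrite ler_pdivlMl //; case/andP: (TY u).
apply: qf_inverse_le E => // u; last by case/andP: (TY u).
by case/andP: (TY u) => + _; apply: le_trans; rewrite mulr_ge0 ?qf_ge0 // ltW.
Qed.

Lemma qf_addmx n (X Y : 'M[K]_n) v : qf (X + Y) v = qf X v + qf Y v.
Proof. by rewrite /qf mulmxDr mulmxDl mxE. Qed.

Lemma qf_scalemx n (X : 'M[K]_n) c v : qf (c *: X) v = c * qf X v.
Proof. by rewrite /qf -scalemxAr -scalemxAl mxE. Qed.

(** * Quadratic inequalities for a saddle point eigenvalue *)

(** Here [a Sh <= Psi^T Ph^-1 Psi <= b Sh], expressed without an inverse
    through [Ph y = Psi v]. *)
Lemma saddle_eigenvalue_quadratics m n (P Ph : 'M[K]_m)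
    (Psi : 'M[K]_(m, n)) (Sh : 'M[K]_n)
    (l u a b x : K) (f : 'cV[K]_m) (w : 'cV[K]_n) :
  posdefmx P -> posdefmx Ph -> posdefmx Sh -> 0 < l -> 0 < a ->
  (forall v, l * qf Ph v <= qf P v <= u * qf Ph v) ->
  (forall v y, Ph *m y = Psi *m v -> a * qf Sh v <= qf Ph y <= b * qf Sh v) ->
  P *m f + Psi *m w = x *: (Ph *m f) -> Psi^T *m f = x *: (Sh *m w) ->
  (f != 0) || (w != 0) ->
  [\/ [/\ x < 0, x ^+ 2 - l * x - b <= 0 & 0 <= x ^+ 2 - u * x - a],
      l <= x <= u |
      [/\ u < x, 0 <= x ^+ 2 - l * x - a & x ^+ 2 - u * x - b <= 0]].
Proof.
move=> pP pPh pSh l0 a0 Pb Sb E1 E2 nz.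
pose y := invmx Ph *m (Psi *m w).
have Phy : Ph *m y = Psi *m w by rewrite /y mulKVmx // posdefmx_unit.
have /andP[ay yb] := Sb w y Phy.
have fw : (f^T *m (Psi *m w)) 0 0 = x * qf Sh w.
  have -> : f^T *m (Psi *m w) = (w^T *m (Psi^T *m f))^T.
    by rewrite !trmx_mul !trmxK mulmxA.
  by rewrite E2 -scalemxAr mxE [LHS]mxE /qf mulmxA.
pose T := x *: Ph - P.
have sT : T^T = T.
  rewrite linearB linearZ /= !trmx_symmetricmx //; last exact: pPh.1.
  exact: pP.1.
have qT v : qf T v = x * qf Ph v - qf P v.
  by rewrite /T qf_addmx qf_scalemx -scaleN1r qf_scalemx mulN1r.
have Tf : T *m f = Ph *m y.
  by rewrite mulmxBl -scalemxAl -E1 addrC addKr.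
have qTf : qf T f = x * qf Sh w by rewrite -fw /qf -mulmxA Tf Phy.
have w0 : f = 0 -> w != 0 by move=> f0; move: nz; rewrite f0 eqxx.
have fnz : f != 0.
  apply/eqP => f0; move: (w0 f0); rewrite (qf_le0 pSh (v := w)) ?eqxx //.
  have y0 : y = 0 by rewrite /y -Phy -Tf f0 mulmx0 mulmx0.
  by rewrite y0 qf0 in ay; rewrite -(pmulr_rle0 _ a0).
have qf_pos : 0 < qf Ph f by exact: pPh.2.
(* The bounds on [P], tested at the nonzero vector [f], force [l <= u]. *)
have lu : l <= u.
  by have /andP[h1 h2] := Pb f; rewrite -(ler_pM2r qf_pos); exact: le_trans h2.
have wnz : x < 0 \/ u < x -> w != 0.
  move=> xlu; apply/negP => /eqP w0'.
  move: qTf; rewrite qT w0' qf0 mulr0 => h.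
  by have /andP[h1 h2] := Pb f; case: xlu => hx; nra.
(* For [x < 0] the positive matrix is [- T], with [- T f = Ph (- y)]. *)
case: (ltP x 0) => x0.
  have qw : 0 < qf Sh w by apply: pSh.2; apply: wnz; left.
  have /andP[] : (l - x) * qf (- T) f <= qf Ph (- y) <= (u - x) * qf (- T) f.
    have lx : 0 < l - x by lra.
    have ux : 0 < u - x by lra.
    apply: qf_inverse_bounds => //.
    - by rewrite linearN /= sT.
    - move=> v; have /andP[h1 h2] := Pb v; rewrite -scaleN1r qf_scalemx qT; lra.
    - by rewrite mulNmx mulmxN Tf.
  rewrite -!scaleN1r qf_scalemx qfZ qTf => h1 h2.
  constructor 1; split=> //.
    have : (x ^+ 2 - l * x - b) * qf Sh w <= 0 by lra.
    by rewrite pmulr_lle0.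
  have : 0 <= (x ^+ 2 - u * x - a) * qf Sh w by lra.
  by rewrite pmulr_lge0.
case: (ltP u x) => xu.
  have qw : 0 < qf Sh w by apply: pSh.2; apply: wnz; right.
  have /andP[] : (x - u) * qf T f <= qf Ph y <= (x - l) * qf T f.
    have lx : 0 < x - l by lra.
    have ux : 0 < x - u by lra.
    apply: qf_inverse_bounds => //.
    move=> v; have /andP[h1 h2] := Pb v; rewrite qT; lra.
  rewrite qTf => h1 h2.
  constructor 3; split=> //.
    have : 0 <= (x ^+ 2 - l * x - a) * qf Sh w by lra.
    by rewrite pmulr_lge0.
  have : (x ^+ 2 - u * x - b) * qf Sh w <= 0 by lra.
  by rewrite pmulr_lle0.
case: (leP l x) => xl; first by constructor 2.
(* For [0 <= x < l], [T] is negative definite, while [f^T T f = x w^T Sh w] is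
   nonnegative. *)
exfalso.
have /andP[h1 h2] := Pb f.
have h5 : 0 <= qf T f by rewrite qTf mulr_ge0 // qf_ge0.
rewrite qT in h5; nra.
Qed.

Lemma qf_eigenvector n (D : 'M[K]_n) (x : K) v :
  D *m v = x *: v -> qf D v = x * qf 1%:M v.
Proof. by move=> E; rewrite /qf -mulmxA E -scalemxAr mulmx1 mxE. Qed.

Lemma posdefmx1 n : posdefmx (1%:M : 'M[K]_n).
Proof.
split; last by move=> v v0; rewrite mulmx1; exact: dotmx_gt0.
by apply/is_hermitianmxP; rewrite expr0 scale1r trmx1 map_mx_id.
Qed.

(** * Extreme eigenvalues and interval bounds *)

(** The supremum and infimum of the spectrum of a positive definite matrix are
    positive and bound its Rayleigh quotients; they are genuine bounds because
    [0 < n] makes the spectrum nonempty. *)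
Lemma qf_extreme_eigenvalues n (D : 'M[K]_n) : (0 < n)%N -> posdefmx D ->
  let E := [set x | eigenvalue D x] in
  [/\ 0 < inf E, 0 < sup E &
    forall v, inf E * qf 1%:M v <= qf D v <= sup E * qf 1%:M v].
Proof.
move=> n0 pD E.
have [e [eE eq]] := pencil_qf pD.1 (posdefmx1 n).
have {}eE i : eigenvalue D (e 0 i) by have := eE i; rewrite invmx1 mul1mx.
have ep i : 0 < e 0 i by exact: posdefmx_eigenvalue_gt0 (eE i).
pose i0 : 'I_n := Ordinal n0.
have Ene : nonempty E by exists (e 0 i0); exact: eE.
(* Crude a priori bounds: every eigenvalue lies between [d^-1] and [c], so the
   spectrum is bounded and bounded away from 0. *)
pose c := \sum_i e 0 i; pose d := \sum_i (e 0 i)^-1.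
have ec i : e 0 i <= c.
  by rewrite /c (bigD1 i) //= lerDl sumr_ge0 // => j _; exact: ltW.
have ed i : (e 0 i)^-1 <= d.
  by rewrite /d (bigD1 i) //= lerDl sumr_ge0 // => j _; rewrite invr_ge0 ltW.
have d0 : 0 < d by apply: lt_le_trans (ed i0); rewrite invr_gt0.
have eigb x : E x -> d^-1 <= x <= c.
  rewrite /E /= -{1}(trmx_symmetricmx pD.1) => /eigenvalue_cV[v Dv v0].
  have := qf_eigenvector Dv; have [w w0 [q1 qD]] := eq v; rewrite qD q1 => h.
  have w1 : 0 < \sum_i w i by rewrite -q1; exact: (posdefmx1 n).2.
  apply/andP; split; rewrite -(ler_pM2r w1) -h mulr_sumr; apply: ler_sum => i _;
    apply: ler_wpM2r => //.
  by rewrite -[leRHS]invrK lef_pV2 ?ed // posrE // invr_gt0.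
have supE : has_sup E by split=> //; exists c => x /eigb/andP[].
have infE : has_inf E by split=> //; exists d^-1 => x /eigb/andP[].
have einf i : inf E <= e 0 i by apply: (ge_inf infE.2); exact: eE.
have esup i : e 0 i <= sup E by apply: (sup_upper_bound supE); exact: eE.
split.
- apply: (@lt_le_trans _ _ d^-1); first by rewrite invr_gt0.
  by apply: lb_le_inf => // x /eigb/andP[].
- exact: lt_le_trans (esup i0).
move=> v; have [w w0 [-> ->]] := eq v.
rewrite !mulr_sumr; apply/andP; split; apply: ler_sum => i _;
  exact: ler_wpM2r.
Qed.

(** The endpoints are roots of [x^2 - c x - d] for [c] among [l], [u] and
    [d] among [a], [b]. *)
Lemma quadratic_intervals (l u a b x : K) : 0 < l -> 0 < u -> 0 <= a -> 0 <= b ->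
  [\/ [/\ x < 0, x ^+ 2 - l * x - b <= 0 & 0 <= x ^+ 2 - u * x - a],
      l <= x <= u |
      [/\ u < x, 0 <= x ^+ 2 - l * x - a & x ^+ 2 - u * x - b <= 0]] ->
  l <= u ->
  (`[(l - Num.sqrt (l ^+ 2 + 4 * b)) / 2, (u - Num.sqrt (u ^+ 2 + 4 * a)) / 2]
   `|` `[l, u]
   `|` `[(l + Num.sqrt (l ^+ 2 + 4 * a)) / 2,
         (u + Num.sqrt (u ^+ 2 + 4 * b)) / 2]) x.
Proof.
move=> l0 u0 a0 b0 h lu.
have sq (c d : K) : 0 <= d -> let s := Num.sqrt (c ^+ 2 + 4 * d) in
    0 <= s /\ s ^+ 2 = c ^+ 2 + 4 * d.
  move=> d0 s; split; first exact: sqrtr_ge0.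
  by rewrite sqr_sqrtr // addr_ge0 ?sqr_ge0 // mulr_ge0.
have [s1 q1] := sq l b b0; have [s2 q2] := sq u a a0.
have [s3 q3] := sq l a a0; have [s4 q4] := sq u b b0.
case: h => [[x0 h1 h2]|h|[x0 h1 h2]].
- left; left; rewrite /= in_itv /=; apply/andP; split.
    rewrite ler_pdivrMr // lerBlDr -lerBlDl.
    rewrite -ler_sqr ?nnegrE //; nra.
  rewrite ler_pdivlMr // lerBrDl -lerBrDr.
  rewrite -ler_sqr ?nnegrE //; nra.
- by left; right; rewrite /= in_itv.
right; rewrite /= in_itv /=; apply/andP; split.
  rewrite ler_pdivrMr // -lerBrDl -ler_sqr ?nnegrE //; nra.
rewrite ler_pdivlMr // -lerBlDl -ler_sqr ?nnegrE //; nra.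
Qed.

Lemma qf_congruence m n (Z : 'M[K]_m) (A : 'M[K]_(m, n)) w :
  qf (A^T *m Z *m A) w = qf Z (A *m w).
Proof. by rewrite /qf trmx_mul !mulmxA. Qed.

Lemma qf_Gram m n (A : 'M[K]_(m, n)) w : qf (A^T *m A) w = qf 1%:M (A *m w).
Proof. by rewrite -qf_congruence mulmx1. Qed.

Lemma qf_invmx n (D : 'M[K]_n) v : posdefmx D ->
  qf (invmx D) v = qf D (invmx D *m v).
Proof.
move=> pD; have Du := posdefmx_unit pD.
by rewrite -qf_congruence trmx_inv (trmx_symmetricmx pD.1) mulVmx // mul1mx.
Qed.

Lemma symmetricmx_trmx n (X : 'M[K]_n) : X^T = X -> X \is symmetricmx.
Proof. by move=> E; apply/is_hermitianmxP; rewrite expr0 scale1r map_mx_id. Qed.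

Lemma posdefmx_Gram n (A : 'M[K]_n) : A \in unitmx -> posdefmx (A^T *m A).
Proof.
move=> Au; split; first by apply: symmetricmx_trmx; rewrite trmx_mul trmxK.
move=> v v0; rewrite -/(qf _ _) qf_Gram; apply: (posdefmx1 n).2.
by apply: contra v0 => /eqP h; rewrite -[v](mulKmx Au) h mulmx0.
Qed.

(** Replacing [L] by [Lh] in [L^T D^-1 L] costs at most the condition number
    of [D]: [D^-1] is sandwiched between multiples of the identity, for which
    the comparison is that of [L^T L] with [Lh^T Lh]. *)
Lemma qf_Schur_precond_bounds n (D L Lh : 'M[K]_n) (lL uL : K)
    (k := condition_number D) :
  (0 < n)%N -> posdefmx D -> Lh \in unitmx -> 0 < lL -> 0 < uL ->
  spectrum_in (invmx (Lh^T *m Lh) *m (L^T *m L)) `[lL, uL] ->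
  0 < k /\ forall w,
  lL / k * qf (Lh^T *m invmx D *m Lh) w <= qf (L^T *m invmx D *m L) w
     <= uL * k * qf (Lh^T *m invmx D *m Lh) w.
Proof.
move=> n0 pD Lu lL0 uL0 sL.
have [i0 s0 Db] := qf_extreme_eigenvalues n0 pD.
have : k = sup [set x | eigenvalue D x] / inf [set x | eigenvalue D x] by [].
clearbody k; move: i0 s0 Db; set S := sup _; set I := inf _ => i0 s0 Db kE.
rewrite kE; split; first by rewrite divr_gt0.
have Dib v : I * qf (invmx D) v <= qf 1%:M v <= S * qf (invmx D) v.
  rewrite !qf_invmx //; apply: qf_inverse_bounds => //.
  - exact: trmx_symmetricmx pD.1.
  - exact: posdefmx1.
  - by rewrite mul1mx mulKVmx // posdefmx_unit.
move=> w; rewrite !qf_congruence.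
have sG : L^T *m L \is symmetricmx.
  by apply: symmetricmx_trmx; rewrite trmx_mul trmxK.
have := pencil_qf_bounds sG (posdefmx_Gram Lu) sL w.
rewrite !qf_Gram => /andP[h1 h2].
have /andP[a1 a2] := Dib (L *m w); have /andP[b1 b2] := Dib (Lh *m w).
have -> : lL / (S / I) = lL * I / S by rewrite invf_div mulrA.
rewrite mulrA; apply/andP; split.
  rewrite mulrAC ler_pdivrMr // [leRHS]mulrC.
  apply: le_trans a2; apply: le_trans h1.
  by rewrite -mulrA ler_pM2l.
rewrite mulrAC ler_pdivlMr // mulrC.
apply: le_trans a1 _; apply: le_trans h2 _.
by rewrite -mulrA ler_pM2l.
Qed.

Lemma qf_block_diag m n (X : 'M[K]_m) (Y : 'M[K]_n) a b :
  qf (block_mx X 0 0 Y) (col_mx a b) = qf X a + qf Y b.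
Proof.
rewrite /qf tr_col_mx mul_row_block !mulmx0 addr0 add0r mul_row_col.
by rewrite mxE.
Qed.

Lemma posdefmx_block_diag m n (X : 'M[K]_m) (Y : 'M[K]_n) :
  posdefmx X -> posdefmx Y -> posdefmx (block_mx X 0 0 Y).
Proof.
move=> pX pY; split.
  apply: symmetricmx_trmx; rewrite tr_block_mx !trmx0.
  by rewrite (trmx_symmetricmx pX.1) (trmx_symmetricmx pY.1).
move=> v; rewrite -[v]vsubmxK; set a := usubmx v; set b := dsubmx v => v0.
rewrite -/(qf _ _) qf_block_diag.
have [a0|a0] := eqVneq a 0; last first.
  by apply: ltr_wpDr; [exact: qf_ge0|exact: pX.2].
apply: ltr_wpDl; [exact: qf_ge0|apply: pY.2].
by apply: contra v0 => /eqP b0; rewrite a0 b0 col_mx0.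
Qed.

(** * Spectrum of the preconditioned saddle point matrix *)

(** The spectral inclusion for arbitrary blocks: the block structure of the
    4D-Var matrices plays no role. *)
Lemma saddle_spectrum m q (D Dh L Lh : 'M[K]_m) (R Rh : 'M[K]_q)
    (H : 'M[K]_(q, m)) (lD uD lR uR lS uS lL uL : K)
    (S := L^T *m invmx D *m L + H^T *m invmx R *m H)
    (St := L^T *m invmx D *m L) (Sh := Lh^T *m invmx D *m Lh)
    (k := condition_number D) (lPhi := Num.min lD lR) (uPhi := Num.max uD uR) :
  (0 < m)%N ->
  posdefmx D -> posdefmx Dh -> posdefmx R -> posdefmx Rh -> Lh \in unitmx ->
  posdefmx S -> posdefmx St -> posdefmx Sh ->
  0 < lD -> 0 < uD -> 0 < lR -> 0 < uR ->
  0 < lS -> 0 < uS -> 0 < lL -> 0 < uL ->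
  spectrum_in (invmx Dh *m D) `[lD, uD] ->
  spectrum_in (invmx Rh *m R) `[lR, uR] ->
  spectrum_in (invmx St *m S) `[lS, uS] ->
  spectrum_in (invmx (Lh^T *m Lh) *m (L^T *m L)) `[lL, uL] ->
  spectrum_in (invmx (block_diag_precond Dh Rh Sh) *m saddle_mx D R L H)
    (`[(lPhi - Num.sqrt (lPhi ^+ 2 + 4 * uPhi * uS * uL * k)) / 2,
       (uPhi - Num.sqrt (uPhi ^+ 2 + 4 * lPhi * lS * lL / k)) / 2]
     `|` `[lPhi, uPhi]
     `|` `[(lPhi + Num.sqrt (lPhi ^+ 2 + 4 * lPhi * lS * lL / k)) / 2,
           (uPhi + Num.sqrt (uPhi ^+ 2 + 4 * uPhi * uS * uL * k)) / 2]).
Proof.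
move=> m0 pD pDh pR pRh Lhu pS pSt pSh lD0 uD0 lR0 uR0 lS0 uS0 lL0 uL0.
move=> sD sR sS sL z ez.
have pP : posdefmx (block_diag_precond Dh Rh Sh).
  by apply: posdefmx_block_diag => //; exact: posdefmx_block_diag.
have sA : saddle_mx D R L H \is symmetricmx.
  apply: symmetricmx_trmx; rewrite /saddle_mx !tr_block_mx.
  rewrite tr_col_mx tr_row_mx !trmxK.
  by rewrite !trmx0 (trmx_symmetricmx pD.1) (trmx_symmetricmx pR.1).
have [x zx [v Av v0]] := pencil_eigenvector_real sA pP ez.
exists x => //.
have l0 : 0 < lPhi by rewrite /lPhi lt_min lD0.
have u0 : 0 < uPhi by rewrite /uPhi lt_max uD0.
pose Phi := block_mx D 0 0 R; pose Phih := block_mx Dh 0 0 Rh.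
have pPhi : posdefmx Phi by exact: posdefmx_block_diag.
have pPhih : posdefmx Phih by exact: posdefmx_block_diag.
have Phib y : lPhi * qf Phih y <= qf Phi y <= uPhi * qf Phih y.
  rewrite -[y]vsubmxK !qf_block_diag !mulrDr.
  have /andP[d1 d2] := pencil_qf_bounds pD.1 pDh sD (usubmx y).
  have /andP[r1 r2] := pencil_qf_bounds pR.1 pRh sR (dsubmx y).
  have qd := qf_ge0 (usubmx y) pDh; have qr := qf_ge0 (dsubmx y) pRh.
  apply/andP; split; apply: lerD.
  - by apply: le_trans d1; apply: ler_wpM2r; rewrite // /lPhi ge_min lexx.
  - by apply: le_trans r1; apply: ler_wpM2r; rewrite // /lPhi ge_min lexx orbT.
  - by apply: le_trans d2 _; apply: ler_wpM2r; rewrite // /uPhi le_max lexx.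
  - by apply: le_trans r2 _; apply: ler_wpM2r; rewrite // /uPhi le_max lexx orbT.
have [k0 Lb] := qf_Schur_precond_bounds m0 pD Lhu lL0 uL0 sL.
rewrite -/k in k0 Lb; clearbody k.
pose Psi := col_mx L H.
pose a := lPhi * lS * lL / k; pose b := uPhi * uS * uL * k.
have Sb w y : Phih *m y = Psi *m w -> a * qf Sh w <= qf Phih y <= b * qf Sh w.
  move=> E; pose p := invmx Phi *m (Psi *m w).
  have Pp : Phi *m p = Phih *m y by rewrite E mulKVmx // posdefmx_unit.
  have qp : qf Phi p = qf S w.
    rewrite -qf_invmx // -qf_congruence /Phi /Psi; congr qf.
    rewrite invmx_block_diag; last exact: posdefmx_unit pPhi.
    by rewrite tr_col_mx mul_row_block !mulmx0 addr0 add0r mul_row_col.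
  have := qf_inverse_bounds (trmx_symmetricmx pPhi.1) pPhih l0 Phib u0 Pp.
  rewrite qp => /andP[h1 h2].
  have /andP[s1 s2] := pencil_qf_bounds pS.1 pSt sS w.
  have /andP[t1 t2] := Lb w.
  apply/andP; split.
    apply: le_trans h1; rewrite /a -!mulrA ler_pM2l //.
    by apply: le_trans s1; rewrite ler_pM2l // mulrA.
  apply: le_trans h2 _; rewrite /b -!mulrA ler_pM2l //.
  by apply: le_trans s2 _; rewrite ler_pM2l // mulrA.
move: Av v0; rewrite -[v]vsubmxK; set f := usubmx v; set w := dsubmx v.
rewrite /saddle_mx /block_diag_precond !mul_block_col !mul0mx addr0 add0r addr0.
rewrite scale_col_mx => /eq_col_mx[E1 E2].
rewrite -tr_col_mx in E2.
rewrite col_mx_eq0 negb_and => nz.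
have a0 : 0 < a by rewrite /a divr_gt0 // !mulr_gt0.
have b0 : 0 < b by rewrite /b !mulr_gt0.
have lu : lPhi <= uPhi.
  have /andP[h1 h2] := Phib (col_mx (const_mx 1) 0).
  (* The witness is a nonzero vector, as [0 < m]. *)
  rewrite -(ler_pM2r (x := qf Phih (col_mx (const_mx 1) 0))).
    exact: le_trans h2.
  apply: pPhih.2; rewrite col_mx_eq0 negb_and; apply/orP; left.
  by apply/eqP => /colP/(_ (Ordinal m0))/eqP; rewrite !mxE oner_eq0.
have := quadratic_intervals l0 u0 (ltW a0) (ltW b0)
  (saddle_eigenvalue_quadratics pPhi pPhih pSh l0 a0 Phib Sb E1 E2 nz) lu.
by rewrite /a /b !mulrA.
Qed.

End QuadraticForms.

Theorem theorem1 (K : realType) (N s p : nat)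
  (hN : (0 < N)%N) (hs : (0 < s)%N) (hp : (0 < p)%N)
  (B : 'M[K]_s) (Q : 'I_N -> 'M[K]_s) (Rb : 'I_N.+1 -> 'M[K]_p)
  (Hb : 'I_N.+1 -> 'M[K]_(p, s)) (M : 'I_N -> 'M[K]_s)
  (Dh Lh : 'M[K]_(\sum_(i < N.+1) s)) (Rh : 'M[K]_(\sum_(i < N.+1) p))
  (lD uD lR uR lS uS lL uL : K) :
  let D := Dmx B Q in
  let R := Rmx Rb in
  let H := Hmx Hb in
  let L := Lmx M in
  let S := L^T *m invmx D *m L + H^T *m invmx R *m H in
  let St := L^T *m invmx D *m L in
  let Sh := Lh^T *m invmx D *m Lh in
  let A := saddle_mx D R L H in
  let PD := block_diag_precond Dh Rh Sh in
  let k := condition_number D in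
  let lPhi := Num.min lD lR in
  let uPhi := Num.max uD uR in
  posdefmx D -> posdefmx Dh -> posdefmx R -> posdefmx Rh ->
  Lh \in unitmx ->
  posdefmx S -> posdefmx St -> posdefmx Sh ->
  0 < lD -> 0 < uD -> 0 < lR -> 0 < uR ->
  0 < lS -> 0 < uS -> 0 < lL -> 0 < uL ->
  spectrum_in (invmx Dh *m D) `[lD, uD] ->
  spectrum_in (invmx Rh *m R) `[lR, uR] ->
  spectrum_in (invmx St *m S) `[lS, uS] ->
  spectrum_in (invmx (Lh^T *m Lh) *m (L^T *m L)) `[lL, uL] ->
  (forall z : K[i], complex_eigenvalue (invmx PD *m A) z -> z \is Num.real) /\
  spectrum_in (invmx PD *m A)
    (`[(lPhi - Num.sqrt (lPhi ^+ 2 + 4 * uPhi * uS * uL * k)) / 2,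
       (uPhi - Num.sqrt (uPhi ^+ 2 + 4 * lPhi * lS * lL / k)) / 2]
     `|` `[lPhi, uPhi]
     `|` `[(lPhi + Num.sqrt (lPhi ^+ 2 + 4 * lPhi * lS * lL / k)) / 2,
           (uPhi + Num.sqrt (uPhi ^+ 2 + 4 * uPhi * uS * uL * k)) / 2]).
Proof.
move=> D R H L S St Sh A PD k lPhi uPhi pD pDh pR pRh uLh pS pSt pSh.
move=> lD0 uD0 lR0 uR0 lS0 uS0 lL0 uL0 sD sR sS sL.
have m0 : (0 < \sum_(i < N.+1) s)%N by rewrite sum_nat_const card_ord muln_gt0.
have sp := saddle_spectrum m0 pD pDh pR pRh uLh pS pSt pSh lD0 uD0 lR0 uR0
  lS0 uS0 lL0 uL0 sD sR sS sL.
split=> // z /sp[x _ ->]; apply/complex_realP; by exists x.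
Qed.
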